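(* Let $P(\lambda)\in\mathbb{C}^{n,n}[\lambda]$ be a matrix polynomial and let $D$ be a nonempty open or closed subset of $\mathbb{C}$. Consider the conditions: (a) the numerical range $W(P)$ does not intersect $D$; (b) $P(\lambda)$ is hyperstable with respect to $D$; (c) $P(\lambda)$ is stable with respect to $D$. Then (a) implies (b), and (b) implies (c).
   Context: The numerical range of $P(\lambda)$ is $W(P):=\{\lambda\in\mathbb{C}: x^*P(\lambda)x=0\text{ for some }x\in\mathbb{C}^n\setminus\{0\}\}$. $P(\lambda)$ is regular if $\det P(\lambda)\not\equiv0$. For a nonempty open or closed $D\subseteq\mathbb{C}$, a regular $P(\lambda)$ is stable with respect to $D$ if $\det P(\mu)\neq0$ for all $\mu\in D$, and hyperstable with respect to $D$ if for every $x\in\mathbb{C}^n\setminus\{0\}$ there exists $y\in\mathbb{C}^n\setminus\{0\}$ such that $y^*P(\mu)x\neq0$ for all $\mu\in D$ (each of these conditions forces regularity). *)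

(* Defs.v *)
From HB Require Import structures.
From mathcomp Require Import all_boot all_order all_algebra.
From mathcomp Require Import complex.
From mathcomp Require Import boolp classical_sets reals topology normedtype.

Set Implicit Arguments.
Unset Strict Implicit.
Unset Printing Implicit Defensive.

Import Order.TTheory GRing.Theory Num.Theory numFieldNormedType.Exports.

Local Open Scope classical_set_scope.
Local Open Scope sesquilinear_scope.
Local Open Scope ring_scope.

(* A matrix polynomial in C^{n,n}[lambda] is encoded as an n x n matrix with
   polynomial entries, so that \det P is a polynomial in lambda. *)
Section MatrixPolynomials.
Variables (C : numClosedFieldType) (n : nat).
Implicit Types (P : 'M[{poly C}]_n) (D : set C).

Definition mxpoly_eval P (mu : C) : 'M[C]_n := map_mx (horner_eval mu) P.

(* The scalars x^* P(lambda) x and y^* P(mu) x below are 1 x 1 matrices. *)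
Definition numerical_range P : set C :=
  [set lambda | exists2 x : 'cV[C]_n,
     x != 0 & x ^t* *m mxpoly_eval P lambda *m x = 0].

Definition regular_mxpoly P : Prop := \det P != 0.

Definition stable P D : Prop :=
  regular_mxpoly P /\ forall mu, D mu -> \det (mxpoly_eval P mu) != 0.

Definition hyperstable P D : Prop :=
  regular_mxpoly P /\
  forall x : 'cV[C]_n, x != 0 ->
    exists2 y : 'cV[C]_n,
      y != 0 & forall mu, D mu -> y ^t* *m mxpoly_eval P mu *m x != 0.

End MatrixPolynomials.

(* Main.v *)
Require Import Defs.
From HB Require Import structures.
From mathcomp Require Import all_boot all_order all_algebra.
From mathcomp Require Import complex.
From mathcomp Require Import boolp classical_sets reals topology normedtype.
Import Order.TTheory GRing.Theory Num.Theory numFieldNormedType.Exports.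
Local Open Scope classical_set_scope.
Local Open Scope sesquilinear_scope.
Local Open Scope ring_scope.

(** Both implications test the form [y^* P(mu) x] on suitable vectors. If [W(P)] misses [D], then
    [y = x] witnesses hyperstability. If [det P(mu) = 0] for some [mu] in [D], a nonzero [x] in the
    kernel of [P(mu)] gives [y^* P(mu) x = 0] for every [y], which contradicts hyperstability. *)

Lemma det0_ker_col (F : fieldType) (n : nat) (A : 'M[F]_n) :
  \det A = 0 -> exists2 x : 'cV[F]_n, x != 0 & A *m x = 0.
Proof.
(* [det0P] yields a row vector in the left kernel, hence the passage to the transpose. *)
rewrite -det_tr => /eqP/det0P[v v0 vA0].
exists v^T; first by rewrite -(inj_eq trmx_inj) trmxK trmx0.
by apply: trmx_inj; rewrite trmx_mul trmxK vA0 trmx0.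
Qed.

(** Evaluation at [mu] is a ring morphism, so it commutes with the determinant. *)
Lemma regular_of_eval (C : numClosedFieldType) (n : nat) (P : 'M[{poly C}]_n)
    (mu : C) :
  \det (mxpoly_eval P mu) != 0 -> regular_mxpoly P.
Proof.
rewrite /mxpoly_eval det_map_mx; apply: contra_neq => ->.
exact: rmorph0.
Qed.

Lemma hyperstable_of_numerical_range (C : numClosedFieldType) (n : nat)
    (P : 'M[{poly C}]_n) (D : set C) :
  D !=set0 -> numerical_range P `&` D = set0 -> hyperstable P D.
Proof.
move=> [mu0 Dmu0] WD0.
have nW mu (x : 'cV[C]_n) : D mu -> x != 0 -> x ^t* *m mxpoly_eval P mu *m x != 0.
  move=> Dmu x0; apply/eqP => Wmu.
  have : (numerical_range P `&` D) mu by split => //; exists x.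
  by rewrite WD0.
split; last by move=> x x0; exists x => // mu Dmu; exact: nW.
(* Regularity is checked at the point [mu0] of [D]: a kernel vector of [P(mu0)] would put [mu0] in
   [W(P)]. *)
apply: (@regular_of_eval _ _ _ mu0); apply/eqP => /det0_ker_col[x x0 Px0].
by have := nW _ _ Dmu0 x0; rewrite -mulmxA Px0 mulmx0 eqxx.
Qed.

Lemma stable_of_hyperstable (C : numClosedFieldType) (n : nat)
    (P : 'M[{poly C}]_n) (D : set C) :
  hyperstable P D -> stable P D.
Proof.
move=> [regP hypP]; split=> // mu Dmu; apply/eqP => /det0_ker_col[x x0 Px0].
have [y _ /(_ _ Dmu)] := hypP _ x0.
by rewrite -mulmxA Px0 mulmx0 eqxx.
Qed.

(* R[i]^o is R[i] with the topology given by its norm. *)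
Theorem proposition2p2 (R : realType) (n : nat) (P : 'M[{poly R[i]}]_n)
    (D : set R[i]) (D_nonempty : D !=set0)
    (D_open_or_closed : open (D : set R[i]^o) \/ closed (D : set R[i]^o)) :
  (numerical_range P `&` D = set0 -> hyperstable P D) /\
  (hyperstable P D -> stable P D).
Proof.
split; first exact: hyperstable_of_numerical_range.
exact: stable_of_hyperstable.
Qed.
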